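(* Every cycle graph $C_n$ of order $n\ge 6$ satisfies $\dim_{ms}(C_n)=3$.
   Context: For a simple connected graph $G$, $d_G(u,v)$ is the length of a shortest $u$–$v$ path. For $S=\{w_1,\ldots,w_t\}\subseteq V(G)$ and $u\in V(G)$, the multiset representation of $u$ with respect to $S$ is the multiset $\operatorname{m}(u|S)$ consisting of $d_G(u,w_1),\ldots,d_G(u,w_t)$, counted with multiplicity. A set $S$ is an outer multiset resolving set if $\operatorname{m}(u|S)\ne \operatorname{m}(v|S)$ for every two distinct $u,v\in V(G)\setminus S$; the outer multiset dimension $\dim_{ms}(G)$ is the minimum cardinality of such a set. *)

(* Defs.v *)
From mathcomp Require Import all_boot finmap multiset.

Set Implicit Arguments.
Unset Strict Implicit.
Unset Printing Implicit Defensive.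

Record cgraph := CGraph {
  vertex :> finType;
  adj : rel vertex;
  adj_sym : symmetric adj;
  adj_irr : irreflexive adj;
  adj_connected : forall u v, connect adj u v
}.

Arguments adj {c}.

(* The path is u :: p, so its length (number of edges) is k = size p. *)
Definition has_path (G : cgraph) (u v : G) (k : nat) : bool :=
  [exists p : k.-tuple G, [&& path adj u p, uniq (u :: p) & last u p == v]].

Lemma has_path_exists (G : cgraph) (u v : G) : exists k, has_path u v k.
Proof.
have /connectP[p] := adj_connected u v.
case/shortenP=> p' e_p' u_p' _ def_v; exists (size p').
by apply/existsP; exists (in_tuple p'); rewrite /= e_p' def_v eqxx andbT.
Qed.

Definition dist (G : cgraph) (u v : G) : nat := ex_minn (has_path_exists u v).

Definition multirep (G : cgraph) (u : G) (S : {set G}) : {mset nat}%mset :=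
  seq_mset [seq dist u w | w <- enum S].

Definition outer_multiset_resolving (G : cgraph) (S : {set G}) : bool :=
  [forall u : G, forall v : G,
    [&& u \notin S, v \notin S & u != v] ==> (multirep u S != multirep v S)].

Definition resolving_card (G : cgraph) (k : nat) : bool :=
  [exists S : {set G}, outer_multiset_resolving S && (#|S| == k)].

Lemma resolving_card_exists (G : cgraph) : exists k, resolving_card G k.
Proof.
exists #|[set: G]|; apply/existsP; exists [set: G]; rewrite eqxx andbT.
by apply/forallP=> u; apply/forallP=> v; rewrite in_setT.
Qed.

Definition outer_multiset_dim (G : cgraph) : nat :=
  ex_minn (resolving_card_exists G).

(* The condition i != j only matters when n = 1; it makes the graph loopless
   for every n, and for n >= 3 this is the usual cycle. *)
Definition cycle_adj (n : nat) : rel 'I_n := fun i j =>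
  (i != j) && ((j == ordS i) || (i == ordS j)).

Lemma cycle_adj_sym n : symmetric (@cycle_adj n).
Proof. by move=> i j; rewrite /cycle_adj eq_sym orbC. Qed.

Lemma cycle_adj_irr n : irreflexive (@cycle_adj n).
Proof. by move=> i; rewrite /cycle_adj eqxx. Qed.

Lemma cycle_adj_connected n (i j : 'I_n) : connect (@cycle_adj n) i j.
Proof.
case: n i j => [[]//|n] i j.
suff con0 (k : 'I_n.+1) : connect (@cycle_adj n.+1) ord0 k.
  apply: connect_trans (con0 j).
  by rewrite (sym_connect_sym (@cycle_adj_sym n.+1)).
case: k; elim=> [|k IHk] lt_k.
  by rewrite (_ : Ordinal lt_k = ord0) //; apply: val_inj.
apply: connect_trans (IHk (ltnW lt_k)) _; apply: connect1.
rewrite /cycle_adj; apply/andP; split; first by rewrite -val_eqE /= ltn_eqF.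
by apply/orP; left; rewrite -val_eqE /= modn_small.
Qed.

Definition cycle_graph (n : nat) : cgraph :=
  CGraph (@cycle_adj_sym n) (@cycle_adj_irr n) (@cycle_adj_connected n).

(* Main.v *)
Require Import Defs.
From mathcomp Require Import all_boot finmap multiset zify.

Set Implicit Arguments.
Unset Strict Implicit.
Unset Printing Implicit Defensive.

(** In [C_n] the distance is [min (|i - j|, n - |i - j|)].  A set [S] with at
    most two elements is stable under a reflection of the cycle, and since the
    reflection fixes at most two vertices, it exchanges two vertices outside
    [S], which then have the same representation.  For [n >= 6] the set
    [{0, 1, 3}] is resolving. *)

(** * Distances and multisets in general *)

(** Since [dist] minimises over simple paths only, an arbitrary walk is first shortened to a simple
    one. *)
Lemma dist_le_path (G : cgraph) (u : G) (p : seq G) :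
  path adj u p -> dist u (last u p) <= size p.
Proof.
case/shortenP=> q path_q uniq_q sub_qp; rewrite /dist.
case: ex_minnP => k _ /(_ (size q)) le_k.
apply: (@leq_trans (size q)).
  apply: le_k; apply/existsP; exists (in_tuple q).
  by rewrite path_q uniq_q eqxx.
by apply: uniq_leq_size sub_qp; case/andP: uniq_q.
Qed.

Lemma dist_path (G : cgraph) (u v : G) :
  exists p : seq G, [/\ path adj u p, last u p = v & size p = dist u v].
Proof.
rewrite /dist; case: ex_minnP => k /existsP[p /and3P[path_p _ /eqP last_p]] _.
by exists p; rewrite size_tuple.
Qed.

Lemma multirep_eqP (G : cgraph) (u v : G) (S : {set G}) :
  reflect (multirep u S = multirep v S)
    (perm_eq [seq dist u w | w <- enum S] [seq dist v w | w <- enum S]).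
Proof. exact: eq_seq_msetP. Qed.

(** An injection of the finite set [S] into itself permutes [S], so the distances from [f u] to [S]
    are those from [f u] to [f x] for [x] in [S]. *)
Lemma multirep_isometry (G : cgraph) (f : G -> G) (S : {set G}) (u : G) :
    injective f -> (forall x y, dist (f x) (f y) = dist x y) ->
    (forall x, x \in S -> f x \in S) ->
  multirep (f u) S = multirep u S.
Proof.
move=> f_inj f_dist f_S; apply/multirep_eqP.
have enum_f : perm_eq (enum S) [seq f x | x <- enum S].
  rewrite perm_sym; apply: uniq_perm; rewrite ?enum_uniq //.
    by rewrite map_inj_uniq ?enum_uniq.
  have sub_f : {subset [seq f x | x <- enum S] <= enum S}.
    by move=> _ /mapP[x xS ->]; move: xS; rewrite !mem_enum; apply: f_S.
  have [] // := uniq_min_size _ sub_f; rewrite ?size_map //.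
  by rewrite map_inj_uniq ?enum_uniq.
rewrite (perm_trans (perm_map _ enum_f)) // -map_comp.
by rewrite (eq_map (f_dist u)).
Qed.

(** Equal supports leave only multiplicities open, as in [a, a, b] against [a, b, b]; equal sums
    settle them. *)
Lemma perm_eq3 (a b c x y z : nat) : perm_eq [:: a; b; c] [:: x; y; z] ->
  [|| [&& a == x, b == y & c == z], [&& a == x, b == z & c == y],
      [&& a == y, b == x & c == z], [&& a == y, b == z & c == x],
      [&& a == z, b == x & c == y] | [&& a == z, b == y & c == x]].
Proof.
move=> perm; have /= sum := perm_sumn perm; have mem := perm_mem perm.
have := mem a; have := mem b; have := mem c.
have := mem x; have := mem y; have := mem z.
rewrite !inE !eqxx !orbT /= => /or3P[] /eqP ? /or3P[] /eqP ? /or3P[] /eqP ?.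
all: by subst; do 3![move/esym/or3P; case=> /eqP ?]; subst; lia.
Qed.

(** * The distance in the cycle *)

(** Subtraction is truncated, so [i - j + (j - i)] is the absolute difference. *)
Definition cdist (n i j : nat) : nat :=
  minn (i - j + (j - i)) (n - (i - j + (j - i))).

Lemma cdistC (n i j : nat) : cdist n i j = cdist n j i.
Proof. by rewrite /cdist addnC. Qed.

Lemma val_ordS (n : nat) (i : 'I_n) :
  val (ordS i) = if i.+1 == n then 0 else i.+1.
Proof.
case: ifP => /= [/eqP-> | ]; first by rewrite modnn.
by move=> ne; rewrite modn_small //; have := ltn_ord i; lia.
Qed.

Lemma cycle_adjE (n : nat) (i j : 'I_n) : 1 < n ->
  cycle_adj i j = [|| j == i.+1 :> nat, i == j.+1 :> nat,
    (i.+1 == n) && (j == 0 :> nat) | (j.+1 == n) && (i == 0 :> nat)].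
Proof.
move=> n_gt1; rewrite /cycle_adj -!val_eqE !val_ordS /=.
by have := ltn_ord i; have := ltn_ord j; do 2!case: ifP; lia.
Qed.

(** An edge changes [cdist] to a fixed endpoint by at most one. *)
Lemma cdist_path_le (n : nat) (i : 'I_n) (p : seq 'I_n) : 1 < n ->
  path (@cycle_adj n) i p -> cdist n i (last i p) <= size p.
Proof.
move=> n_gt1; elim: p i => [|j p IHp] i /=; first by rewrite /cdist; lia.
rewrite cycle_adjE // => /andP[adj_ij /IHp].
move: (last j p) => k; rewrite /cdist.
have := ltn_ord i; have := ltn_ord j; have := ltn_ord k; lia.
Qed.

Lemma cdist_path (n : nat) (i j : 'I_n) : 1 < n ->
  exists p, [/\ path (@cycle_adj n) i p, last i p = j & size p = cdist n i j].
Proof.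
move=> n_gt1; move def_k: (cdist n i j) => k.
elim: k i def_k => [|k IHk] i def_k.
  exists [::]; split=> //=; apply: val_inj => /=.
  by move: def_k; rewrite /cdist; have := ltn_ord i; have := ltn_ord j; lia.
have [i' adj_i' def_i'] : exists2 i' : 'I_n, cycle_adj i i' & cdist n i' j = k.
  have lt_in := ltn_ord i; have lt_jn := ltn_ord j.
  have lt_pred : (if i == 0 :> nat then n.-1 else i.-1) < n by case: ifP; lia.
  move: def_k; rewrite /cdist => def_k.
  (* The neighbour [i'] is one step along a shorter arc: towards [j] directly if the difference is
     at most [n / 2], and the other way round otherwise. *)
  have [le_ij | lt_ji] := leqP i j; have [near | far] := leqP (i - j + (j - i)).*2 n.
  - exists (ordS i); rewrite ?cycle_adjE ?val_ordS //; case: ifP; lia.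
  - exists (Ordinal lt_pred); rewrite ?cycle_adjE //=; case: ifP; lia.
  - exists (Ordinal lt_pred); rewrite ?cycle_adjE //=; case: ifP; lia.
  - exists (ordS i); rewrite ?cycle_adjE ?val_ordS //; case: ifP; lia.
have [p [path_p last_p size_p]] := IHk i' def_i'.
by exists (i' :: p); rewrite /= adj_i' path_p size_p.
Qed.

Lemma dist_cycle (n : nat) (i j : cycle_graph n) : 1 < n ->
  dist i j = cdist n i j.
Proof.
move=> n_gt1; apply/eqP; rewrite eqn_leq; apply/andP; split.
  have [p [path_p <- <-]] := cdist_path i j n_gt1.
  exact: (@dist_le_path (cycle_graph n)).
have [p [path_p <- <-]] := dist_path i j.
exact: cdist_path_le.
Qed.

(** * Lower bound by reflections *)

(** Either [S] is empty or [S = {a, b}], with [a = b] allowed; in both cases exchanging [a] and [b]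
    preserves [S]. *)
Lemma card_le2_pair (T : finType) (x0 : T) (S : {set T}) : #|S| <= 2 ->
  exists a b, S \subset [set a; b] /\ (a \in S) = (b \in S).
Proof.
case def_k: #|S| => [|[|[|//]]] _.
- by exists x0, x0; rewrite (cards0_eq def_k) sub0set.
- by have /cards1P[a ->] := introT eqP def_k; exists a, a; rewrite setUid.
have /cards2P[a [b [_ ->]]] := introT eqP def_k.
by exists a, b; rewrite subxx !inE !eqxx orbT.
Qed.

(* The map [u |-> c - u] on [Z/n], for [c < 2 n] and [u < n]. *)
Definition reflect_nat (n c u : nat) : nat :=
  let t := c + n - u in
  if t < n then t else if t < 2 * n then t - n else t - 2 * n.

Lemma reflect_nat_lt (n c u : nat) : c < 2 * n -> u < n -> reflect_nat n c u < n.
Proof. by rewrite /reflect_nat; case: ifP; [lia|case: ifP; lia]. Qed.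

Lemma reflect_natK (n c u : nat) : c < 2 * n -> u < n ->
  reflect_nat n c (reflect_nat n c u) = u.
Proof. by rewrite /reflect_nat => *; do !case: ifP; lia. Qed.

Lemma cdist_reflect (n c u v : nat) : c < 2 * n -> u < n -> v < n ->
  cdist n (reflect_nat n c u) (reflect_nat n c v) = cdist n u v.
Proof.
move=> lt_c; wlog le_uv : u v / u <= v => [wlog_uv lt_u lt_v|lt_u lt_v].
  case: (leqP u v) => [|/ltnW] le_uv; first exact: wlog_uv.
  by rewrite cdistC wlog_uv // cdistC.
(* Orientation is reversed: the arc of length [v - u] now runs from the image of [v] to that of [u],
   and the second case is the one where it passes through the wrap-around. *)
have : reflect_nat n c u = reflect_nat n c v + (v - u) \/
       reflect_nat n c v = reflect_nat n c u + (n - (v - u)).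
  by rewrite /reflect_nat; do !case: ifP; lia.
by have := reflect_nat_lt lt_c lt_u; rewrite /cdist; lia.
Qed.

(** A fixed point solves [2u = a + b] modulo [n], which has at most two solutions. With [a] and [b]
    this excludes at most four vertices, so one of [0, ..., 4] survives. *)
Lemma reflect_nat_moved (n a b : nat) : 5 < n -> a < n -> b < n ->
  exists2 u, u < n & [/\ u != a, u != b & reflect_nat n (a + b) u != u].
Proof.
move=> n_gt5 lt_an lt_bn.
(* For [u < n] and [a + b < 2n], the congruence can hold only through one of three equalities,
   negated here. *)
pose ok u := [&& u != a, u != b, u.*2 != a + b, u.*2 + n != a + b & u.*2 != a + b + n].
have : [|| ok 0, ok 1, ok 2, ok 3 | ok 4] by rewrite /ok; lia.
have okP u : u < 5 -> ok u ->
    exists2 u, u < n & [/\ u != a, u != b & reflect_nat n (a + b) u != u].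
  move=> lt_u5 ok_u; exists u; first lia.
  by move: ok_u; rewrite /ok /reflect_nat; split; do ?case: ifP; lia.
by do ![case/orP] => /okP; apply.
Qed.

Lemma cycle_not_resolving (n : nat) (S : {set cycle_graph n}) :
  5 < n -> #|S| <= 2 -> ~~ outer_multiset_resolving S.
Proof.
move=> n_gt5 /card_le2_pair pairS.
have n_gt0 : 0 < n by lia.
have [a [b [S_ab S_a_b]]] := pairS (Ordinal n_gt0).
have lt_an := ltn_ord a; have lt_bn := ltn_ord b.
have lt_c : a + b < 2 * n by lia.
(* The constant [a + b] makes the reflection exchange [a] and [b]. *)
pose r (u : 'I_n) := Ordinal (reflect_nat_lt lt_c (ltn_ord u)).
have r_inj : injective r.
  by apply: (can_inj (g := r)) => u; apply/val_inj/reflect_natK.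
have [u lt_un [ne_ua ne_ub moved]] := reflect_nat_moved n_gt5 lt_an lt_bn.
pose u' : 'I_n := Ordinal lt_un.
have uS : u' \notin S.
  by apply: contra (subsetP S_ab u') _; rewrite !inE negb_or -!val_eqE ne_ua.
have r_S x : x \in S -> r x \in S.
  move=> xS; have := subsetP S_ab x xS; rewrite !inE => /orP[] /eqP def_x.
    rewrite (_ : r x = b) -?S_a_b -?def_x //; apply: val_inj.
    by rewrite def_x /= /reflect_nat; do ?case: ifP; lia.
  rewrite (_ : r x = a) ?S_a_b -?def_x //; apply: val_inj.
  by rewrite def_x /= /reflect_nat; do ?case: ifP; lia.
have ruS : r u' \notin S.
  by apply: contra uS => /r_S; congr (_ \in S); apply/val_inj/reflect_natK.
rewrite /outer_multiset_resolving; apply/forallPn; exists (r u').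
apply/forallPn; exists u'; rewrite uS ruS -val_eqE /= moved /= negbK.
apply/eqP/multirep_isometry => // x y.
by rewrite !dist_cycle ?cdist_reflect //; lia.
Qed.

(** * Upper bound by the set [{0, 1, 3}] *)

(** The thresholds [n - x], [n - x + 2] and [n - x + 6] are where the shorter arc from [x] to 0, 1
    and 3 respectively changes side; between them all three distances are linear in [x]. *)
Lemma cdist_013 (n x : nat) : 5 < n -> x < n -> x \notin [:: 0; 1; 3] ->
  [\/ [/\ x = 2, cdist n x 0 = 2, cdist n x 1 = 1 & cdist n x 3 = 1],
      [/\ 3 < x <= n - x, cdist n x 0 = x, cdist n x 1 = x - 1
        & cdist n x 3 = x - 3],
      [/\ 3 < x /\ n - x < x <= n - x + 2, cdist n x 0 = n - x,
          cdist n x 1 = x - 1 & cdist n x 3 = x - 3]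
    | 3 < x /\
      ([/\ n - x + 2 < x <= n - x + 6, cdist n x 0 = n - x,
           cdist n x 1 = n - x + 1 & cdist n x 3 = x - 3] \/
       [/\ n - x + 6 < x, cdist n x 0 = n - x, cdist n x 1 = n - x + 1
         & cdist n x 3 = n - x + 3])].
Proof.
rewrite !inE /cdist => n_gt5 lt_xn x_notin.
have [x_le3 | x_gt3] := leqP x 3; first by apply: Or41; split; lia.
have [x_le | x_gt] := leqP x (n - x); first by apply: Or42; split; lia.
have [x_le1 | x_gt1] := leqP x (n - x + 2); first by apply: Or43; split; lia.
apply: Or44; split=> //.
by have [x_le2 | x_gt2] := leqP x (n - x + 6); [left | right]; split; lia.
Qed.

Lemma cycle_resolving3 (n : nat) : 5 < n -> resolving_card (cycle_graph n) 3.
Proof.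
move=> n_gt5.
have n_gt0 : 0 < n by lia.
have n_gt1 : 1 < n by lia.
have n_gt3 : 3 < n by lia.
(* The gaps 1, 2 and [n - 3] are distinct for [n >= 6], so only the trivial symmetry of the cycle
   preserves this set. *)
pose s : seq (cycle_graph n) :=
  [:: Ordinal n_gt0; Ordinal n_gt1; Ordinal n_gt3].
have uniq_s : uniq s by [].
apply/existsP; exists [set x in s]; rewrite cardsE (card_uniqP uniq_s) andbT.
have enum_s : perm_eq (enum [set x in s]) s.
  by apply: uniq_perm; rewrite ?enum_uniq // => x; rewrite mem_enum inE.
apply/forallP=> u; apply/forallP=> v; apply/implyP=> /and3P[uS vS ne_uv].
apply: contra ne_uv => /eqP/multirep_eqP.
rewrite (permPl (perm_map _ enum_s)) (permPr (perm_map _ enum_s)) /=.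
move/perm_eq3; rewrite !dist_cycle //=.
have := cdist_013 n_gt5 (ltn_ord u); have := cdist_013 n_gt5 (ltn_ord v).
move: uS vS; rewrite !inE -!val_eqE /= => uS vS /(_ vS) v_cases /(_ uS) u_cases.
have lt_un := ltn_ord u; have lt_vn := ltn_ord v.
(* Each of the 25 pairs of regions, with each of the six matchings of distances, gives a linear
   system that is contradictory or forces [u = v]. *)
case: u_cases v_cases => [[? -> -> ->] | [? -> -> ->] | [? -> -> ->]
  | [? [] [? -> -> ->]]] [[? -> -> ->] | [? -> -> ->] | [? -> -> ->]
  | [? [] [? -> -> ->]]].
all: by do 5?[case/orP]; case/and3P => /eqP ? /eqP ? /eqP ?; lia.
Qed.

Theorem mainTheorem7 (n : nat) (hn : 6 <= n) :
  outer_multiset_dim (cycle_graph n) = 3.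
Proof.
rewrite /outer_multiset_dim; case: ex_minnP => k /existsP[S /andP[S_res /eqP card_S]].
move=> /(_ 3 (cycle_resolving3 hn)) k_le3; apply/eqP; rewrite eqn_leq k_le3 ltnNge.
by apply: contraL S_res => k_le2; apply: cycle_not_resolving; rewrite ?card_S.
Qed.
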